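(* Let $\bm X_1,\dots,\bm X_n$ be an i.i.d. sample from a $d$-variate random vector $\bm X$ with continuous marginal cdfs $F_1,\dots,F_d$ whose stable tail dependence function $L$ exists and satisfies $L(\bm x)=\sum_{a\in[K]}\max_{j\in[d]}\bar A_{ja}x_j$ for all $\bm x\in[0,\infty)^d$, for some (unknown) $(K,\bar A)\in\Theta_L$. Let $k\in[n]$, fix $\delta\in(0,1)$, and let $\kappa_0=\kappa_0(\delta,n,k,d)$ and $\eta=\eta(\bar A)$ be as defined in the context. Then, with probability at least $1-\delta$, if the tuning parameter $\kappa$ of the PureVar algorithm is chosen such that $\kappa\in[\kappa_0,\eta/2)$, the following statements are true for any choice of the maximum clique made in the algorithm: (i) $\hat K=K$ and $\hat I=I$. (ii) There exists a permutation $\pi$ of $[K]$ such that $\hat I_a=I_{\pi(a)}$ for every $a\in[K]$.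
   Context: Notation: $[m]=\{1,\dots,m\}$, $x\wedge y=\min(x,y)$. Stable tail dependence function of $\bm X$: $L(\bm x)=\lim_{n\to\infty}n\,\mathbb P\{F_1(X_1)>1-x_1/n\text{ or }\dots\text{ or }F_d(X_d)>1-x_d/n\}$, $\bm x\in[0,\infty)^d$. Tail correlations: $\chi(j,\ell)=\lim_{n\to\infty}n\,\mathbb P\{F_j(X_j)>1-1/n,\,F_\ell(X_\ell)>1-1/n\}$. Parameter space: $\Theta_L$ is the set of pairs $(K,\bar A)$ with $K\in[d]$ and $\bar A\in[0,\infty)^{d\times K}$ having all row sums equal to $1$ and satisfying the pure variable assumption: for each $a\in[K]$, the set $I_a=\{j\in[d]:\bar A_{ja}>0\text{ and }\bar A_{jb}=0\ \forall b\ne a\}$ is non-empty. The pure variable set is $I=\bigcup_{a\in[K]}I_a$. Signal strength: $\eta=\eta(\bar A)=\min\{\bar A_{ja}\wedge(1-\bar A_{ja}): j\in[d],a\in[K],\ \bar A_{ja}\notin\{0,1\}\}\in(0,1/2]$, with the convention $\eta=1/2$ if this set is empty. Bias: $\chi_{n,k}(j,\ell)=\frac nk\mathbb P\{F_j(X_j)>1-k/n,\ F_\ell(X_\ell)>1-k/n\}$ and $D(k/n)=\sup_{j,\ell\in[d],j\neq\ell}|\chi_{n,k}(j,\ell)-\chi(j,\ell)|$. Further, $$\kappa_0=D(k/n)+\frac{\sqrt2+\sqrt{16\ln(d/\delta)}+\sqrt{16\ln(4d/\delta)}}{\sqrt k}+\frac{6+4\ln(d/\delta)+8\ln(4d/\delta)}{3k}.$$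 Empirical tail correlations: $\hat\chi_{n,k}(j,\ell)=\frac1k\sum_{i=1}^n\mathbf 1(R_{i,j}>n-k,\ R_{i,\ell}>n-k)$, where $R_{i,j}$ is the rank of $X_{i,j}$ among $X_{1,j},\dots,X_{n,j}$ (ties broken at random). PureVar algorithm with tuning parameter $\kappa\in(0,1/2)$: let $\hat G$ be the undirected graph on vertex set $[d]$ in which distinct $j,\ell$ are joined by an edge iff $\hat\chi_{n,k}(j,\ell)\le\kappa$. Choose a maximum clique (a clique of maximal cardinality) $\hat C=\{\hat j_1,\dots,\hat j_{\hat K}\}$ of $\hat G$, with $\hat K=|\hat C|$. For $a\in[\hat K]$ put $\hat I_a=\{\hat j_a\}\cup\{\ell\in[d]:\hat\chi_{n,k}(\hat j_a,\ell)\ge1-\kappa\}$, and $\hat I=\hat I_1\cup\dots\cup\hat I_{\hat K}$. The output is $(\hat K,\hat I,\{\hat I_1,\dots,\hat I_{\hat K}\})$. *)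

(* Defs.v *)
From HB Require Import structures.
From mathcomp Require Export all_boot all_order all_algebra all_fingroup.
From mathcomp Require Export all_classical all_reals all_analysis.
Export Order.TTheory GRing.Theory Num.Theory.
Export numFieldNormedType.Exports.

Set Implicit Arguments.
Unset Strict Implicit.
Unset Printing Implicit Defensive.

Local Open Scope ring_scope.

(* Variables in [d] and factors in [K] are indexed by 'I_d and 'I_K.  Finite
   sets carry the delimiter %SET, sets of outcomes the delimiter %classic. *)

Section Loadings.
Context (R : realType) (d K : nat).
Implicit Types (A : 'M[R]_(d, K)) (a : 'I_K).

Definition pure_set A a : {set 'I_d} :=
  [set j | (0 < A j a) && [forall b, (b != a) ==> (A j b == 0)]]%SET.

Definition pure_union A : {set 'I_d} := (\bigcup_a pure_set A a)%SET.

Definition in_ThetaL A : Prop :=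
  [/\ (0 < K <= d)%N,
      forall j a, 0 <= A j a,
      forall j, \sum_a A j a = 1
    & forall a, pure_set A a != finset.set0].

(* For A in Theta_L every minimand below lies in (0, 1/2], so the initial value
   1/2 is only attained as the convention for an empty range or by an entry
   equal to 1/2. *)
Definition eta A : R :=
  \big[Num.min/2^-1]_(p : 'I_d * 'I_K | (A p.1 p.2 != 0) && (A p.1 p.2 != 1))
     Num.min (A p.1 p.2) (1 - A p.1 p.2).

(* All terms are nonnegative for nonnegative A and x, so starting the maximum
   at 0 is harmless. *)
Definition linear_factor_stdf A (x : 'I_d -> R) : R :=
  \sum_a \big[Num.max/0]_j (A j a * x j).

End Loadings.

Section RandomVector.
Context (R : realType) (disp : measure_display) (T : measurableType disp)
        (P : probability T R) (d : nat).
Implicit Types (X : {RV P >-> d.-tuple R}).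

Definition coord X (j : 'I_d) : T -> R := fun w => tnth (X w) j.

Lemma measurable_coord X j : measurable_fun setT (coord X j).
Proof.
exact: (measurableT_comp (measurable_tnth j) (measurable_funPT X)).
Qed.

HB.instance Definition _ X j :=
  isMeasurableFun.Build _ _ _ _ (coord X j) (measurable_coord X j).

Definition margin_cdf X (j : 'I_d) : R -> \bar R :=
  cdf (coord X j : {RV P >-> R}).

Definition Pr (E : set T) : R := fine (P E).

Definition tail_event X (j : 'I_d) (u : R) : set T :=
  [set w | ((1 - u)%:E < margin_cdf X j (coord X j w))%E]%classic.

Definition is_stdf X (L : ('I_d -> R) -> R) : Prop :=
  forall x : 'I_d -> R, (forall j, 0 <= x j) ->
    ((fun m : nat =>
        m%:R * Pr [set w | exists j, tail_event X j (x j / m%:R) w])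
      @ \oo --> L x)%classic.

Definition chi X (j l : 'I_d) : R :=
  (limn (fun m : nat =>
     m%:R * Pr (tail_event X j m%:R^-1 `&` tail_event X l m%:R^-1)))%classic.

Definition chi_nk X (n k : nat) (j l : 'I_d) : R :=
  n%:R / k%:R *
  Pr (tail_event X j (k%:R / n%:R) `&` tail_event X l (k%:R / n%:R))%classic.

(* The supremum over an empty set of pairs (d <= 1) is 0. *)
Definition bias X (n k : nat) : R :=
  \big[Num.max/0]_(p : 'I_d * 'I_d | p.1 != p.2)
     `|chi_nk X n k p.1 p.2 - chi X p.1 p.2|.

Definition kappa0 X (delta : R) (n k : nat) : R :=
  bias X n k
  + (Num.sqrt 2 + Num.sqrt (16 * ln (d%:R / delta))
     + Num.sqrt (16 * ln (4 * d%:R / delta))) / Num.sqrt k%:R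
  + (6 + 4 * ln (d%:R / delta) + 8 * ln (4 * d%:R / delta)) / (3 * k%:R).

(* Mutual independence of the whole vectors; subfamilies are covered by taking
   B i to be the full space.  The sigma-algebra of d.-tuple R is the product
   one, i.e. the Borel sets of R^d. *)
Definition iid_sample X (n : nat) (Xs : 'I_n -> {RV P >-> d.-tuple R}) : Prop :=
  (forall i (B : set (d.-tuple R)), measurable B ->
     distribution P (Xs i) B = distribution P X B) /\
  (forall B : 'I_n -> set (d.-tuple R), (forall i, measurable (B i)) ->
     P [set w | forall i, B i (Xs i w)]%classic
     = (\prod_(i < n) P (Xs i @^-1` B i)%classic)%E).

End RandomVector.

Section Algorithm.
Context (R : realType) (d n : nat).

(* Rank, in {1, ..., n}, of x i among x 0, ..., x (n-1); ties are broken by the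
   order of the values of the permutation s, so random tie-breaking is a random
   choice of s. *)
Definition rank_of (x : 'I_n -> R) (s : 'S_n) (i : 'I_n) : nat :=
  #|[set i' | (x i' < x i) || ((x i' == x i) && (s i' <= s i)%N)]%SET|.

Definition chi_hat (k : nat) (x : 'I_n -> d.-tuple R) (s : 'I_d -> 'S_n)
    (j l : 'I_d) : R :=
  k%:R^-1 *
  #|[set i | (n - k < rank_of (fun i' => tnth (x i') j) (s j) i)%N
           && (n - k < rank_of (fun i' => tnth (x i') l) (s l) i)%N]%SET|%:R.

Definition is_clique (e : rel 'I_d) (C : {set 'I_d}) : Prop :=
  forall j l, j \in C -> l \in C -> j != l -> e j l.

Definition is_max_clique (e : rel 'I_d) (C : {set 'I_d}) : Prop :=
  is_clique e C /\ forall C', is_clique e C' -> (#|C'| <= #|C|)%N.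

Definition chi_graph (c : 'I_d -> 'I_d -> R) (kappa : R) : rel 'I_d :=
  fun j l => (j != l) && (c j l <= kappa).

(* The possible outputs of PureVar run on the empirical tail correlations c:
   jhat enumerates, in some order, the chosen maximum clique. *)
Definition purevar_output (c : 'I_d -> 'I_d -> R) (kappa : R) (Khat : nat)
    (Ihat : {set 'I_d}) (Ihats : 'I_Khat -> {set 'I_d}) : Prop :=
  exists jhat : 'I_Khat -> 'I_d,
    [/\ injective jhat,
        is_max_clique (chi_graph c kappa) [set jhat a | a : 'I_Khat]%SET,
        forall a, Ihats a =
          (jhat a |: [set l | (1 - kappa <= c (jhat a) l)])%SET
      & Ihat = (\bigcup_a Ihats a)%SET].

End Algorithm.

(* Main.v *)
(* In the linear factor model chi(j, l) = sum_a min(A j a, A l a), read off from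
   L at e_j, e_l and e_j + e_l.  It is 0 exactly when the rows j and l have
   disjoint supports and is at least eta otherwise; for a pure j of factor a it
   equals A l a, which is 1 or at most 1 - eta.  Estimating every chi(j, l)
   within kappa < eta / 2 therefore turns cliques into families of variables
   with disjoint supports, and a maximum clique has one pure variable per
   factor.
   For the estimation error, the k largest observations of a coordinate and
   the observations with F_j(X_j) > 1 - k/n are both upper sets of one total
   order, hence nested, so the rank-based estimator differs from the one with
   known margins by at most the fluctuations of two Bin(n, k/n) counts.  These
   and the joint counts are controlled by Chernoff's bound and a union bound.
   If kappa0 >= eta / 2, no kappa is admissible; otherwise kappa0 < 1/4, hence
   256 ln(4d/delta) <= k, which keeps Chernoff's bound in its Gaussian regime. *)
Require Import Defs.
From mathcomp Require Import ring lra zify measurable_realfun.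

Set Implicit Arguments.
Unset Strict Implicit.
Unset Printing Implicit Defensive.

Local Open Scope ring_scope.

(** * Recovery from approximate tail correlations *)

Section Recovery.
Context (R : realType) (d K : nat).
Implicit Types (A : 'M[R]_(d, K)) (a b : 'I_K) (j l : 'I_d).

Definition tail_corr A j l : R := \sum_a Num.min (A j a) (A l a).

Lemma eta_le_half A : eta A <= 2^-1.
Proof. exact: bigmin_le_id. Qed.

Lemma eta_le_entry A j a : A j a != 0 -> A j a != 1 ->
  eta A <= A j a /\ eta A <= 1 - A j a.
Proof.
move=> n0 n1; have : eta A <= Num.min (A j a) (1 - A j a).
  by apply: (bigmin_le_cond _ (j := (j, a))); rewrite /= n0 n1.
by rewrite le_min => /andP.
Qed.

(** Rows are nonnegative and sum to 1: a lone positive entry must be 1, and an entry 1 leaves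
    nothing for the others. *)
Lemma pure_setP A j a : in_ThetaL A -> (j \in pure_set A a) = (A j a == 1).
Proof.
move=> [_ A0 A1 _]; rewrite inE; apply/andP/eqP => [[_ /forallP Ab]|Aja].
  rewrite -(A1 j) (bigD1 a) //= big1 ?addr0 // => b ba.
  by have /implyP/(_ ba)/eqP := Ab b.
split; first by rewrite Aja.
apply/forallP => b; apply/implyP => ba.
have := A1 j; rewrite (bigD1 a) //= Aja -[RHS]addr0 => /addrI/eqP.
by rewrite psumr_eq0 // => /allP /(_ b (mem_index_enum b)) /implyP; apply.
Qed.

Lemma in_ThetaL_le1 A j a : in_ThetaL A -> A j a <= 1.
Proof.
by move=> [_ A0 A1 _]; rewrite -(A1 j) (bigD1 a) //= lerDl sumr_ge0.
Qed.

Lemma tail_corr_eq0 A j l : in_ThetaL A ->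
  (forall a, A j a = 0 \/ A l a = 0) -> tail_corr A j l = 0.
Proof.
move=> [_ A0 _ _] dis; apply: big1 => a _.
by have [->|->] := dis a; [exact/min_idPl | exact/min_idPr].
Qed.

(** Were both entries nonzero, each would be at least [eta A] (by definition of [eta], or because it
    is 1), so the summand at [a] alone would reach [eta A]. *)
Lemma tail_corr_lt_eta A j l a : in_ThetaL A -> tail_corr A j l < eta A ->
  A j a = 0 \/ A l a = 0.
Proof.
move=> [_ A0 _ _] small.
have [->|nj] := eqVneq (A j a) 0; first by left.
have [->|nl] := eqVneq (A l a) 0; first by right.
suff : eta A <= tail_corr A j l by rewrite leNgt small.
have eta1 : eta A <= 1.
  by apply: le_trans (eta_le_half A) _; rewrite invf_le1 ?ltr0n // ler1n.
have entry i : A i a != 0 -> eta A <= A i a.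
  move=> ni; have [->//|ni1] := eqVneq (A i a) 1.
  by have [] := eta_le_entry ni ni1.
rewrite /tail_corr (bigD1 a) //= -[leLHS]addr0 lerD //.
  by rewrite le_min !entry.
by apply: sumr_ge0 => b _; rewrite le_min !A0.
Qed.

Lemma tail_corr_pure A j l a : in_ThetaL A -> j \in pure_set A a ->
  tail_corr A j l = A l a.
Proof.
move=> hA ja; have [_ A0 _ _] := hA.
rewrite /tail_corr (bigD1 a) //= big1 => [|b ba].
  move: ja; rewrite pure_setP // => /eqP ->.
  by rewrite addr0 (min_idPr _) // in_ThetaL_le1.
move: ja; rewrite inE => /andP[_ /forallP/(_ b)/implyP/(_ ba)/eqP ->].
by rewrite (min_idPl _).
Qed.

Lemma exists_entry_neq0 A j : in_ThetaL A -> exists a, A j a != 0.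
Proof.
move=> [_ _ A1 _]; apply/existsP; apply: contraT.
rewrite negb_exists => /forallP A0.
have := A1 j; rewrite big1 => [/eqP|a _]; first by rewrite eq_sym oner_eq0.
by have := A0 a; rewrite negbK => /eqP.
Qed.

(** The deterministic core. The error is controlled off the diagonal only, since the algorithm never
    has to trust [c j j]. *)
Lemma purevar_recovery A (c : 'I_d -> 'I_d -> R) (kappa : R) (Khat : nat)
    (Ihat : {set 'I_d}) (Ihats : 'I_Khat -> {set 'I_d}) :
  in_ThetaL A -> 0 <= kappa -> kappa < eta A / 2 ->
  (forall j l, j != l -> `|c j l - tail_corr A j l| <= kappa) ->
  purevar_output c kappa Ihat Ihats ->
  exists eK : Khat = K,
    Ihat = pure_union A /\
    exists pi : {perm 'I_K}, forall a : 'I_Khat,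
      Ihats a = pure_set A (pi (cast_ord eK a)).
Proof.
move=> hA k0 keta err [jhat [jinj [cl mx] IhatsE ->]].
(* An edge gives [tail_corr A j l <= 2 * kappa < eta A]. *)
have edge j l : chi_graph c kappa j l -> forall a, A j a = 0 \/ A l a = 0.
  move=> /andP[jl cjl] a; apply: tail_corr_lt_eta => //.
  by have := err _ _ jl; rewrite ler_norml => /andP[? _]; lra.
have edge' j l : j != l -> (forall a, A j a = 0 \/ A l a = 0) ->
    chi_graph c kappa j l.
  move=> jl dis; rewrite /chi_graph jl /=.
  by have := err _ _ jl; rewrite tail_corr_eq0 // subr0 ler_norml => /andP[].
have [_ A0 _ A_pure] := hA.
(* [f j] is some factor loaded by [j]. Clique members have disjoint supports, so [f] is injective on
   the clique and [Khat <= K]. *)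
pose f j := xchoose (exists_entry_neq0 j hA).
have fP j : A j (f j) != 0 by exact: (xchooseP (exists_entry_neq0 j hA)).
have f_jhat : injective (f \o jhat).
  move=> a b /= fab; apply: contraTeq isT => ab.
  have jab : jhat a != jhat b by rewrite (inj_eq jinj).
  have [] := edge _ _ (cl _ _ (imset_f _ isT) (imset_f _ isT) jab) (f (jhat a)).
    by move/eqP; rewrite (negPf (fP _)).
  by rewrite fab => /eqP; rewrite (negPf (fP _)).
(* One pure variable per factor forms a clique of size [K], which the maximum clique cannot
   undercut. *)
have Kle : (K <= Khat)%N.
  have pureP a : exists j, j \in pure_set A a.
    exact/set0Pn.
  pose p a := xchoose (pureP a).
  have pP a : p a \in pure_set A a by exact: (xchooseP (pureP a)).
  have p0 a b : b != a -> A (p a) b = 0.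
    move=> ba; have := pP a.
    by rewrite inE => /andP[_ /forallP/(_ b)/implyP/(_ ba)/eqP].
  have pinj : injective p.
    move=> a b pab; apply: contraTeq isT => ab.
    have := pP a; rewrite pure_setP // pab p0 // => /eqP/eqP.
    by rewrite eq_sym oner_eq0.
  have := mx [set p a | a : 'I_K]%SET.
  rewrite !card_imset // !card_ord.
  apply=> _ _ /imsetP[a _ ->] /imsetP[b _ ->] pab.
  apply: edge' => // e; have [->|ea] := eqVneq e a; last by left; apply: p0.
  by right; apply: p0; apply: contraNneq pab => ->.
have eK : Khat = K.
  apply/eqP; rewrite eqn_leq Kle andbT.
  by have := leq_card _ f_jhat; rewrite !card_ord.
subst Khat; exists erefl.
pose pi := perm f_jhat.
(* Each factor other than [pi a] is loaded by another clique member, so by disjointness [jhat a] can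
   load only [pi a]. *)
have jpure a : jhat a \in pure_set A (pi a).
  rewrite inE; apply/andP; split.
    by rewrite permE lt_neqAle eq_sym fP A0.
  apply/forallP => b; apply/implyP => ba; apply/eqP.
  have bE : b = f (jhat ((pi^-1)%g b)) by rewrite -[RHS](permE f_jhat) permKV.
  have a'a : jhat a != jhat ((pi^-1)%g b).
    by rewrite (inj_eq jinj); apply: contraNneq ba => ->; rewrite permKV.
  have [] // := edge _ _ (cl _ _ (imset_f _ isT) (imset_f _ isT) a'a) b.
  by rewrite {2}bE => /eqP; rewrite (negPf (fP _)).
have setE a : Ihats a = pure_set A (pi a).
  rewrite IhatsE; apply/setP => l; rewrite !inE.
  have [->|la] /= := eqVneq l (jhat a).
    by have := jpure a; rewrite inE => ->.
  have := pure_setP l (pi a) hA; rewrite inE => ->.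
  have := err (jhat a) l; rewrite eq_sym la => /(_ isT).
  rewrite (tail_corr_pure l hA (jpure a)) ler_norml => /andP[lo hi].
  apply/idP/eqP => [h|Al]; last by lra.
  (* Passing the threshold forces [A l (pi a) >= 1 - 2 * kappa > 1 - eta A], which excludes 0, as
     [eta A <= 1/2], and every value strictly between 0 and 1. *)
  have eta2 := eta_le_half A; apply/eqP; apply: contraT => n1.
  have [Al0|n0] := eqVneq (A l (pi a)) 0; first by lra.
  by have [_ ?] := eta_le_entry n0 n1; lra.
split; last by exists pi => a; rewrite cast_ord_id setE.
rewrite /pure_union [RHS](reindex_inj (@perm_inj _ pi)) /=.
by apply: eq_bigr => a _; rewrite setE.
Qed.
End Recovery.

(** * Marginal tails and the limit tail correlations *)

Section Probability.
Context (R : realType) (disp : measure_display) (T : measurableType disp)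
        (P : probability T R).
Implicit Types (E F : set T).
Local Open Scope classical_set_scope.

Lemma PrE E : measurable E -> (Pr P E)%:E = P E.
Proof. by move=> mE; rewrite /Pr fineK // fin_num_measure. Qed.

Lemma Pr_ge0 E : 0 <= Pr P E.
Proof. exact/fine_ge0/measure_ge0. Qed.

Lemma le_Pr E F : measurable E -> measurable F -> E `<=` F -> Pr P E <= Pr P F.
Proof. by move=> mE mF EF; rewrite -lee_fin !PrE // le_measure // inE. Qed.

Lemma Pr_le1 E : measurable E -> Pr P E <= 1.
Proof. by move=> mE; rewrite -lee_fin PrE // probability_le1. Qed.

Lemma Pr_setC E : measurable E -> Pr P (~` E) = 1 - Pr P E.
Proof.
move=> mE; apply: EFin_inj; rewrite EFinB !PrE ?probability_setC //.
exact: measurableC.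
Qed.

Lemma Pr_setI E F : measurable E -> measurable F ->
  Pr P (E `&` F) = Pr P E + Pr P F - Pr P (E `|` F).
Proof.
move=> mE mF.
have mEF : measurable (E `&` F) by exact: measurableI.
have mEUF : measurable (E `|` F) by exact: measurableU.
suff : Pr P (E `|` F) = Pr P E + Pr P F - Pr P (E `&` F) by move->; ring.
apply: EFin_inj; rewrite EFinB EFinD !PrE // measureUfinr //.
exact: le_lt_trans (probability_le1 P mF) (ltry _).
Qed.

Lemma Pr_exists_le (I : finType) (D : pred I) (E : I -> set T) :
  (forall i, measurable (E i)) ->
  Pr P [set w | exists2 i, D i & E i w] <= \sum_(i | D i) Pr P (E i).
Proof.
move=> mE.
have mbig (r : seq I) : measurable (\big[setU/set0]_(i <- r | D i) E i).
  by apply: bigsetU_measurable.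
have -> : [set w | exists2 i, D i & E i w] = \big[setU/set0]_(i | D i) E i.
  rewrite -bigcup_seq_cond; apply/seteqP; split => w /=.
    by move=> [i Di Ei]; exists i; rewrite //= mem_index_enum.
  by move=> [i /andP[_ Di] Ei]; exists i.
elim: (index_enum I) => [|i r IH]; first by rewrite !big_nil /Pr measure0.
rewrite !big_cons; case: ifP => // _.
have := Pr_ge0 (E i `&` \big[setU/set0]_(i <- r | D i) E i).
by rewrite Pr_setI //; lra.
Qed.

(** Intermediate value theorem between the limits 0 and 1 of the cdf. *)
Lemma exists_cdf_eq (Y : {RV P >-> R}) (v : R) : continuous (cdf Y) ->
  0 < v < 1 -> exists q, cdf Y q = v%:E.
Proof.
move=> Yc /andP[v0 v1].
pose f := fine \o cdf Y.
have fK x : (f x)%:E = cdf Y x.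
  by rewrite /f /= fineK // fin_num_measure.
have fc : continuous f.
  by move=> x; apply: fine_cvg; rewrite fK; exact: Yc.
have f_nd : {homo f : x y / x <= y}.
  by move=> x y xy; rewrite -lee_fin !fK cdf_nondecreasing.
have [a fa] : exists a, f a < v.
  have [M [_ HM]] := cvgr_lt _ (fine_cvg (cvg_cdfNy0 Y)) _ v0.
  by exists (M - 1); apply: HM; rewrite ltrBlDr ltrDl.
have [b fb] : exists b, v < f b.
  have [M [_ HM]] := cvgr_gt _ (fine_cvg (cvg_cdfy1 Y)) _ v1.
  by exists (M + 1); apply: HM; rewrite ltrDl.
have ab : a <= b.
  rewrite leNgt; apply/negP => /ltW /f_nd ba.
  by have := lt_trans fa fb; rewrite ltNge ba.
have [|q _ fq] := @IVT R f a b v ab (continuous_subspaceT fc).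
  by rewrite ge_min (ltW fa) /= le_max (ltW fb) orbT.
by exists q; rewrite -fK fq.
Qed.

Lemma Pr_cdf_le (Y : {RV P >-> R}) (v : R) : continuous (cdf Y) ->
  0 <= v < 1 -> Pr P [set w | (cdf Y (Y w) <= v%:E)%E] = v.
Proof.
move=> Yc /andP[v0 v1].
have mY : measurable_fun setT (Y : T -> R) by exact: measurable_funPT.
have mle z : measurable [set w | (cdf Y (Y w) <= z%:E)%E].
  have mF : measurable_fun setT (cdf Y \o (Y : T -> R)).
    by apply: measurableT_comp mY; exact: cdf_measurable.
  rewrite -[X in measurable X]setTI.
  exact: emeasurable_fun_infty_c.
have mYle q : measurable (Y @^-1` `]-oo, q]).
  by rewrite -[X in measurable X]setTI; apply: mY.
have PrY q z : cdf Y q = z%:E -> Pr P (Y @^-1` `]-oo, q]) = z.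
  by move=> qz; apply: EFin_inj; rewrite PrE.
apply/eqP; rewrite eq_le; apply/andP; split.
  apply/ler_addgt0Pl => e e0.
  (* The cdf may be flat at level [v], so a preimage of [v] need not bound the event from the right.
     A preimage [q] of a slightly larger level [z < 1] does: a cdf value at most [v < z] forces
     [Y w <= q]. *)
  pose z := Num.min (v + e) ((v + 1) / 2).
  have vz : v < z by rewrite lt_min; apply/andP; split; lra.
  have z1 : z < 1 by rewrite gt_min; apply/orP; right; lra.
  have z01 : 0 < z < 1 by rewrite z1 (le_lt_trans v0 vz).
  have [q qz] := exists_cdf_eq Yc z01.
  apply: le_trans (_ : z <= _); last by rewrite ge_min addrC lexx.
  rewrite -(PrY _ _ qz); apply: le_Pr => // w /= wv; rewrite in_itv /= leNgt.
  apply/negP => /ltW /(cdf_nondecreasing Y); rewrite qz => zw.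
  by have := le_trans zw wv; rewrite lee_fin leNgt vz.
have [v_gt0|v_le0] := ltP 0 v; last exact: le_trans v_le0 (Pr_ge0 _).
have v01 : 0 < v < 1 by rewrite v_gt0.
have [q qv] := exists_cdf_eq Yc v01.
rewrite -[leLHS](PrY _ _ qv); apply: le_Pr => // w /=.
by rewrite in_itv /= -qv; exact: cdf_nondecreasing.
Qed.

(** * Tail events of the coordinates and [chi] in the linear factor model *)

Section Tails.
Context (d : nat) (X : {RV P >-> d.-tuple R}).
Implicit Types (j l : 'I_d).

(** Independence is phrased through subsets of R^d, so the tail event is recast as the preimage of
    one. *)
Definition tail_region j (u : R) : set (d.-tuple R) :=
  [set x | ((1 - u)%:E < margin_cdf X j (tnth x j))%E].

Lemma tail_event_preimage j u : tail_event X j u = X @^-1` tail_region j u.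
Proof. by []. Qed.

Lemma measurable_tail_region j u : measurable (tail_region j u).
Proof.
have mF : measurable_fun setT
    (margin_cdf X j \o (fun x : d.-tuple R => tnth x j)).
  apply: measurableT_comp (measurable_tnth j); exact: cdf_measurable.
by rewrite -[X in measurable X]setTI; apply: emeasurable_fun_o_infty.
Qed.

Lemma measurable_tail_event j u : measurable (tail_event X j u).
Proof.
rewrite tail_event_preimage -[X in measurable X]setTI.
by apply: (measurable_funPT X) => //; exact: measurable_tail_region.
Qed.

Lemma tail_event0 j : tail_event X j 0 = set0.
Proof.
apply/seteqP; split => // w; rewrite /tail_event /= subr0 ltNge.
by rewrite /margin_cdf cdf_le1.
Qed.

Lemma Pr_tail_event j u : continuous (margin_cdf X j) -> 0 < u <= 1 ->
  Pr P (tail_event X j u) = u.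
Proof.
move=> Fc /andP[u0 u1].
have := Pr_setC (measurable_tail_event j u).
have -> : ~` tail_event X j u =
    [set w | (margin_cdf X j (coord X j w) <= (1 - u)%:E)%E].
  by apply/seteqP; split => w /=; rewrite /tail_event /= leNgt => /negP.
rewrite Pr_cdf_le //; first by lra.
by apply/andP; split; lra.
Qed.

(** Inclusion-exclusion turns the joint tail into [L(e_j) + L(e_l) - L(e_j + e_l)]. The first two
    values are row sums, hence 1, and min = sum - max termwise. *)
Lemma chi_tail_corr (K : nat) (A : 'M[R]_(d, K)) (L : ('I_d -> R) -> R) j l :
  is_stdf X L -> in_ThetaL A ->
  (forall x : 'I_d -> R, (forall j, 0 <= x j) ->
     L x = linear_factor_stdf A x) ->
  j != l -> chi X j l = tail_corr A j l.
Proof.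
move=> hL [_ A0 A1 _] hLA jl.
pose e (C : pred 'I_d) (i : 'I_d) : R := (C i)%:R.
have e0 C i : 0 <= e C i by exact: ler0n.
have LE C : L (e C) = \sum_a \big[Num.max/0]_(i | C i) A i a.
  rewrite hLA //; apply: eq_bigr => a _; rewrite [RHS]bigmax_mkcond.
  by apply: eq_bigr => i _; rewrite /e; case: (C i); rewrite ?mulr1 ?mulr0.
have L1 i : L (e (pred1 i)) = 1.
  rewrite LE -(A1 i); apply: eq_bigr => a _.
  rewrite (bigmaxD1 i) /= ?eqxx // big_pred0 ?(max_idPl (A0 _ _)) // => i'.
  by case: eqVneq.
have L2 : L (e (pred2 j l)) = \sum_a Num.max (A j a) (A l a).
  rewrite LE; apply: eq_bigr => a _.
  rewrite (bigmaxD1 j) /= ?eqxx // (bigmaxD1 l) /=; last first.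
    by rewrite eqxx orbT eq_sym jl.
  rewrite big_pred0 ?(max_idPl (A0 _ _)) // => i.
  by case: eqVneq => //= _; case: eqVneq.
(* Coordinates outside [C] enter at level 0, where the tail event is empty. *)
have cvgL (C : pred 'I_d) :
    (fun m : nat =>
       m%:R * Pr P [set w | exists2 i, C i & tail_event X i m%:R^-1 w]) @ \oo
    --> L (e C).
  apply: cvg_trans (hL (e C) (e0 C)); apply: near_eq_cvg; near=> m.
  congr (_ * Pr P _); apply/seteqP; split => w /= [i].
    rewrite /e; case: (boolP (C i)) => [Ci|Ci].
      by rewrite mul1r; exists i.
    by rewrite mul0r tail_event0.
  by move=> Ci iw; exists i; rewrite /e Ci mul1r.
have cvg1 i : (fun m : nat => m%:R * Pr P (tail_event X i m%:R^-1)) @ \oo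
    --> (1 : R).
  have := cvgL (pred1 i); rewrite L1; apply: cvg_trans.
  apply: near_eq_cvg; near=> m.
  congr (_ * Pr P _); apply/seteqP; split => w /=; first by move=> [i' /eqP->].
  by exists i => /=.
have cvg2 :
    (fun m : nat =>
       m%:R * Pr P (tail_event X j m%:R^-1 `|` tail_event X l m%:R^-1)) @ \oo
    --> \sum_a Num.max (A j a) (A l a).
  rewrite -L2; apply: cvg_trans (cvgL (pred2 j l)).
  apply: near_eq_cvg; near=> m.
  congr (_ * Pr P _); apply/seteqP; split => w /=.
    by move=> [i' /orP[]/eqP->]; [left|right].
  by move=> [|] ?; [exists j | exists l]; rewrite //= eqxx ?orbT.
rewrite /chi; apply: cvg_lim => //.
have -> : tail_corr A j l = 1 + 1 - \sum_a Num.max (A j a) (A l a).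
  rewrite /tail_corr -{1}(A1 j) -(A1 l) -big_split -sumrB.
  apply: eq_bigr => a _ /=.
  by rewrite -(addr_max_min (A j a)) addrAC subrr add0r.
apply: cvg_trans (cvgB (cvgD (cvg1 j) (cvg1 l)) cvg2).
apply: near_eq_cvg; near=> m.
rewrite /= Pr_setI; [|exact: measurable_tail_event..].
by rewrite mulrBr mulrDr.
Unshelve. all: by end_near.
Qed.

End Tails.
End Probability.

(** * Ranks *)

Section Ranks.
Context (R : realType) (n : nat).
Implicit Types (x : 'I_n -> R) (s : 'S_n) (i : 'I_n).

Definition top_set (k : nat) x s : {set 'I_n} :=
  [set i | (n - k < rank_of x s i)%N]%SET.

(** The total order whose initial segments [rank_of] counts. *)
Definition tie_le x s : rel 'I_n :=
  fun i i' => (x i < x i') || ((x i == x i') && (s i <= s i')%N).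

Lemma tie_le_refl x s : reflexive (tie_le x s).
Proof. by move=> i; rewrite /tie_le eqxx leqnn orbT. Qed.

Lemma tie_le_total x s : total (tie_le x s).
Proof.
by move=> i i'; rewrite /tie_le; case: ltgtP => //= _; exact: leq_total.
Qed.

Lemma tie_le_anti x s : antisymmetric (tie_le x s).
Proof.
move=> i i'; rewrite /tie_le; case: ltgtP => //= _ ss.
exact/(@perm_inj _ s)/val_inj/anti_leq.
Qed.

Lemma tie_le_trans x s : transitive (tie_le x s).
Proof.
move=> i i' i''; rewrite /tie_le.
move=> /orP[h1|/andP[/eqP-> h1]] /orP[h2|/andP[/eqP h2 h2']].
- by rewrite (lt_trans h1 h2).
- by rewrite -h2 h1.
- by rewrite h2.
- by rewrite h2 eqxx (leq_trans h1 h2') orbT.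
Qed.

(** Initial segments of a total order are nested, and strictly so for distinct endpoints, since each
    contains its own endpoint. *)
Lemma leq_rank_of x s i i' :
  (rank_of x s i <= rank_of x s i')%N = tie_le x s i i'.
Proof.
have mono j j' : tie_le x s j j' -> (rank_of x s j <= rank_of x s j')%N.
  move=> jj'; apply/subset_leq_card/fintype.subsetP => l.
  by rewrite !inE => /tie_le_trans; apply.
apply/idP/idP => [|]; last exact: mono.
have [//|/negP ii'] := boolP (tie_le x s i i').
have i'i : tie_le x s i' i by case/orP: (tie_le_total x s i i').
rewrite leqNgt => /negP; case; apply/proper_card/properP; split.
  by apply/fintype.subsetP => l; rewrite !inE => /tie_le_trans; apply.
by exists i; rewrite inE; [exact: tie_le_refl | exact/negP].
Qed.

Lemma rank_of_inj x s : injective (rank_of x s).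
Proof.
move=> i i' ii'; apply: (@tie_le_anti x s).
by rewrite -!leq_rank_of ii' leqnn.
Qed.

Lemma rank_of_gt0 x s i : (0 < rank_of x s i)%N.
Proof. by apply/card_gt0P; exists i; rewrite inE; exact: tie_le_refl. Qed.

Lemma rank_of_le x s i : (rank_of x s i <= n)%N.
Proof. by rewrite -[leqRHS]card_ord max_card. Qed.

Lemma card_top_set k x s : (k <= n)%N -> #|top_set k x s| = k.
Proof.
move=> kn.
(* Ranks are distinct and lie in 1..n; lowered by one they form a permutation of ['I_n], so the top
   set is the preimage of the last [k] indices. *)
have lt_rank i : ((rank_of x s i).-1 < n)%N.
  by rewrite prednK ?rank_of_gt0 ?rank_of_le.
pose r i := Ordinal (lt_rank i).
have r_inj : injective r.
  move=> i i' [] /(congr1 S); rewrite !prednK ?rank_of_gt0 //.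
  exact: rank_of_inj.
pose p := perm r_inj.
have -> : top_set k x s = p @^-1: [set i : 'I_n | (n - k <= i)%N].
  apply/setP => i; rewrite !inE permE /=.
  by case: (rank_of x s i) (rank_of_gt0 x s i).
rewrite -(card_imset _ (@perm_inj _ p)).
have -> : (p @: (p @^-1: [set i : 'I_n | (n - k <= i)%N]))%SET
    = [set i : 'I_n | (n - k <= i)%N]%SET.
  apply/setP => i; apply/imsetP/idP => [[j]|ip]; first by rewrite !inE => ? ->.
  by exists ((p^-1)%g i); rewrite ?inE permKV //; move: ip; rewrite inE.
have -> : [set i : 'I_n | (n - k <= i)%N]%SET
    = (~: [set i : 'I_n | (i < n - k)%N])%SET.
  by apply/setP => i; rewrite !inE leqNgt.
rewrite cardsCs finset.setCK card_ord.
have -> : #|[set i : 'I_n | (i < n - k)%N]%SET| = (n - k)%N.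
  have nkn : (n - k <= n)%N by rewrite leq_subr.
  have winj : injective (widen_ord nkn).
    by move=> i j /(congr1 val) ij; exact: val_inj.
  rewrite -[RHS](card_ord (n - k)) -(card_imset _ winj).
  apply: eq_card => i; rewrite inE; apply/idP/imsetP => [ik|[j _ ->]].
    by exists (Ordinal ik) => //; apply: val_inj.
  exact: (ltn_ord j).
by rewrite subKn.
Qed.

(** [B] is closed under equal values too, hence an upper set of [tie_le] however ties are broken;
    two upper sets of a total order are comparable. *)
Lemma top_set_nested k x s (B : {set 'I_n}) :
  (forall i i', i \in B -> x i <= x i' -> i' \in B) ->
  (top_set k x s \subset B) || (B \subset top_set k x s).
Proof.
move=> Bup; apply: contraT; rewrite negb_or => /andP[].
move=> /fintype.subsetPn[i iS iB] /fintype.subsetPn[i' i'B i'S].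
have [ii'|i'i] := orP (tie_le_total x s i i').
  move: iS i'S; rewrite !inE -leqNgt => iS i'S.
  have := leq_rank_of x s i i'; rewrite ii' => le.
  by move: (leq_trans iS le); rewrite ltnNge i'S.
case/negP: iB; apply: Bup i'B _.
by move: i'i => /orP[/ltW //|/andP[/eqP-> _]].
Qed.

End Ranks.

(** Truncated subtraction covers both inclusions: for [A \subset B] both sides are 0. *)
Lemma nested_diff (T : finType) (A B : {set T}) :
  (A \subset B) || (B \subset A) -> #|A :\: B|%SET = (#|A| - #|B|)%N.
Proof.
case/orP => AB.
  have -> : A :\: B = finset.set0 by apply/eqP; rewrite finset.setD_eq0.
  by rewrite cards0; apply/esym/eqP/subset_leq_card.
by rewrite cardsD (finset.setIidPr AB).
Qed.

Lemma nested_cap_dist (R : realType) (T : finType) (A1 A2 B1 B2 : {set T})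
    (e : R) :
  (A1 \subset B1) || (B1 \subset A1) -> (A2 \subset B2) || (B2 \subset A2) ->
  `|#|B1|%:R - #|A1|%:R| <= e -> `|#|B2|%:R - #|A2|%:R| <= e ->
  `|#|A1 :&: A2|%:R - #|B1 :&: B2|%:R| <= 2 * e.
Proof.
have half (C1 C2 D1 D2 : {set T}) : (C1 \subset D1) || (D1 \subset C1) ->
    (C2 \subset D2) || (D2 \subset C2) ->
    `|#|C1|%:R - #|D1|%:R| <= e -> `|#|C2|%:R - #|D2|%:R| <= e ->
    #|C1 :&: C2|%:R - #|D1 :&: D2|%:R <= 2 * e :> R.
  move=> n1 n2 e1 e2.
  (* A point of [C1 :&: C2] outside [D1 :&: D2] lies in [C1 :\: D1] or [C2 :\: D2], whose sizes
     nesting reduces to differences of cardinalities. *)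
  have card_le : (#|(C1 :&: C2)%SET|
      <= #|(D1 :&: D2)%SET| + (#|C1| - #|D1|) + (#|C2| - #|D2|))%N.
    rewrite -!nested_diff // -addnA.
    apply: (@leq_trans
        #|((D1 :&: D2) :|: ((C1 :\: D1) :|: (C2 :\: D2)))%SET|).
      apply/subset_leq_card/fintype.subsetP => t; rewrite !inE => /andP[-> ->].
      by case: (t \in D1); case: (t \in D2).
    apply: leq_trans (leq_card_setU _ _) _; rewrite leq_add2l.
    exact: leq_card_setU.
  have sub_le (a b : nat) : `|a%:R - b%:R| <= e -> (a - b)%:R <= e.
    move=> ab; have [ba|/ltnW ba] := leqP b a.
      by rewrite natrB //; apply: le_trans ab; apply: ler_norm.
    by move/eqP: ba => ->; exact: le_trans (normr_ge0 _) ab.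
  have := sub_le _ _ e1; have := sub_le _ _ e2.
  by move: card_le; rewrite -(ler_nat R) !natrD; lra.
move=> n1 n2 e1 e2; rewrite ler_norml; apply/andP; split; last first.
  by apply: half; rewrite ?(distrC #|A1|%:R) ?(distrC #|A2|%:R).
by rewrite lerNl opprB; apply: half; rewrite // orbC.
Qed.

(** * Binomial concentration *)

Section FinitelyValued.
Context (disp : measure_display) (T : measurableType disp).
Local Open Scope classical_set_scope.

Definition fin_measurable (F : finType) (f : T -> F) : Prop :=
  forall y, measurable [set w | f w = y].

(** A finite union of fibres, so [Q] may be arbitrary; this is what makes the event of the theorem
    measurable. *)
Lemma fin_measurable_prop (F : finType) (f : T -> F) (Q : F -> Prop) :
  fin_measurable f -> measurable [set w | Q (f w)].
Proof.
move=> mf.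
have -> : [set w | Q (f w)] = \bigcup_(y in Q) [set w | f w = y].
  by apply/seteqP; split => w /=; [exists (f w) | move=> [y Qy ->]].
by apply: fin_bigcup_measurable => [|y _]; [exact: finite_finset | exact: mf].
Qed.

Lemma fin_measurable_comp (F G : finType) (f : T -> F) (g : F -> G) :
  fin_measurable f -> fin_measurable (g \o f).
Proof. by move=> mf y; apply: (fin_measurable_prop (fun z => g z = y) mf). Qed.

Lemma fin_measurable_ffun (I F : finType) (f : I -> T -> F) :
  (forall i, fin_measurable (f i)) ->
  fin_measurable (fun w => [ffun i => f i w]).
Proof.
move=> mf y.
have -> : [set w | [ffun i => f i w] = y]
    = \bigcap_(i in [set: I]) [set w | f i w = y i].
  apply/seteqP; split => w /=; first by move=> <- i _ /=; rewrite ffunE.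
  by move=> fy; apply/ffunP => i; rewrite ffunE; exact: fy.
by apply: fin_bigcap_measurable => [|i _]; [exact: finite_finset | exact: mf].
Qed.

Lemma fin_measurable_pair (F G : finType) (f : T -> F) (g : T -> G) :
  fin_measurable f -> fin_measurable g -> fin_measurable (fun w => (f w, g w)).
Proof.
move=> mf mg [y z].
have -> : [set w | (f w, g w) = (y, z)]
    = [set w | f w = y] `&` [set w | g w = z].
  by apply/seteqP; split => w /= [-> ->].
by apply: measurableI; [exact: mf | exact: mg].
Qed.

Lemma fin_measurable_bool (b : T -> bool) :
  measurable [set w | b w] -> fin_measurable b.
Proof.
move=> mb [//|]; have -> : [set w | b w = false] = ~` [set w | b w].
  by apply/seteqP; split => w /=; [move=> -> | move/negP/negbTE].
exact: measurableC.
Qed.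

Lemma fin_measurable_set (I : finType) (b : I -> T -> bool) :
  (forall i, measurable [set w | b i w]) ->
  fin_measurable (fun w => [set i | b i w]%SET).
Proof.
move=> mb.
have mf : fin_measurable (fun w => [ffun i => b i w]).
  by apply: fin_measurable_ffun => i; exact: fin_measurable_bool.
have := fin_measurable_comp (fun f : {ffun I -> bool} => [set i | f i]%SET) mf.
congr fin_measurable; apply/funext => w /=.
by apply/setP => i; rewrite !inE ffunE.
Qed.

End FinitelyValued.

(** Inverting [1 - x/2 <= expR (- x/2)] and squaring gives [expR x <= (1 - x/2)^-2]. The quadratic
    dominates this because [1 - 3x + x^2 >= 0] for [x <= 1/4]. *)
Lemma expR_le_quadratic (R : realType) (x : R) :
  `|x| <= 4^-1 -> expR x <= 1 + x + x ^+ 2.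
Proof.
rewrite ler_norml => /andP[xlo xhi].
have h : 1 - x / 2 <= expR (- (x / 2)) by have := expR_ge1Dx (- (x / 2)).
have hx : 0 < 1 - x / 2 by lra.
have -> : expR x = ((expR (- (x / 2))) ^+ 2)^-1.
  by rewrite -expRM_natl -expRN; congr expR; field.
apply: le_trans (_ : ((1 - x / 2) ^+ 2)^-1 <= _).
  rewrite lef_pV2 ?posrE ?exprn_gt0 ?expR_gt0 //.
  by rewrite ler_pXn2r // nnegrE ?expR_ge0 // ltW.
rewrite -[leLHS]mul1r ler_pdivrMr ?exprn_gt0 //.
have : 0 <= x ^+ 2 / 4 * (1 - 3 * x + x ^+ 2).
  by apply: mulr_ge0; [rewrite divr_ge0 ?sqr_ge0 | have := sqr_ge0 x; lra].
move=> gap; rewrite -subr_ge0.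
by have -> : (1 + x + x ^+ 2) * (1 - x / 2) ^+ 2 - 1
  = x ^+ 2 / 4 * (1 - 3 * x + x ^+ 2) by field.
Qed.

(** * Chernoff bounds for the number of sample points in a region *)

Section Concentration.
Context (R : realType) (disp : measure_display) (T : measurableType disp)
        (P : probability T R) (d n : nat) (X : {RV P >-> d.-tuple R})
        (Xs : 'I_n -> {RV P >-> d.-tuple R}).
Context (iidXs : iid_sample X Xs).
Local Open Scope classical_set_scope.

(** Kept as an index set, not a count, so that joint exceedances are intersections and compare with
    top sets. *)
Definition hits (B : set (d.-tuple R)) (w : T) : {set 'I_n} :=
  [set i | `[< B (Xs i w) >]]%SET.

Lemma fin_measurable_hits B : measurable B -> fin_measurable (hits B).
Proof.
move=> mB; apply: fin_measurable_set => i.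
have -> : [set w | `[< B (Xs i w) >]] = Xs i @^-1` B.
  by apply/seteqP; split => w /= /asboolP.
by rewrite -[X in measurable X]setTI; apply: (measurable_funPT (Xs i)).
Qed.

Lemma measurable_RV_preimage (Y : {RV P >-> d.-tuple R}) B :
  measurable B -> measurable (Y @^-1` B).
Proof.
by move=> mB; rewrite -[X in measurable X]setTI; apply: (measurable_funPT Y).
Qed.

Lemma Pr_hits_eq B (S : {set 'I_n}) p : measurable B ->
  Pr P (X @^-1` B) = p ->
  Pr P [set w | hits B w = S] = \prod_i (if i \in S then p else 1 - p).
Proof.
move=> mB pE; have [ident indep] := iidXs.
pose C (i : 'I_n) := if i \in S then B else ~` B.
have mC i : measurable (C i).
  by rewrite /C; case: ifP => // _; exact: measurableC.
have -> : [set w | hits B w = S] = [set w | forall i, C i (Xs i w)].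
  apply/seteqP; split => w /=.
    move=> hS i; rewrite /C -hS inE; case: asboolP => //.
  move=> CX; apply/setP => i; rewrite inE; have := CX i; rewrite /C.
  by case: ifP => _ H; [exact/asboolP | apply/asboolPn].
apply: EFin_inj; rewrite PrE ?indep //; last first.
  have -> : [set w | forall i, C i (Xs i w)]
      = \bigcap_(i in [set: 'I_n]) (Xs i @^-1` C i).
    by apply/seteqP; split => w /= h i; [move=> _|]; apply: h.
  apply: fin_bigcap_measurable => [|i _]; first exact: finite_finset.
  exact: measurable_RV_preimage.
rewrite -prodEFin; apply: eq_bigr => i _.
have -> : P (Xs i @^-1` C i) = P (X @^-1` C i) by exact: ident.
rewrite -PrE; last exact: measurable_RV_preimage.
congr EFin; rewrite /C; case: ifP => // _.
by rewrite preimage_setC Pr_setC ?pE //; exact: measurable_RV_preimage.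
Qed.

(** Exponential Markov inequality, carried out as a finite sum over the values [S] of [hits B].
    [lambda] may have either sign, which serves both tails. *)
Lemma Pr_hits_mgf B (lambda t p : R) : measurable B ->
  Pr P (X @^-1` B) = p ->
  Pr P [set w | t <= lambda * (#|hits B w|%:R - n%:R * p)]
  <= expR (n%:R * p * (expR lambda - 1 - lambda) - t).
Proof.
move=> mB pE.
have p0 : 0 <= p by rewrite -pE Pr_ge0.
have p1 : p <= 1 by rewrite -pE Pr_le1 //; exact: measurable_RV_preimage.
pose D (S : {set 'I_n}) := t <= lambda * (#|S|%:R - n%:R * p).
have -> : [set w | t <= lambda * (#|hits B w|%:R - n%:R * p)]
    = [set w | exists2 S, D S & [set w | hits B w = S] w].
  by apply/seteqP; split => w /=; [exists (hits B w) | move=> [S DS ->]].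
have mhits : forall S, measurable [set w | hits B w = S].
  exact: fin_measurable_hits.
apply: le_trans (Pr_exists_le P D mhits) _.
pose q (S : {set 'I_n}) := \prod_(i : 'I_n) (if i \in S then p else 1 - p).
have q0 S : 0 <= q S by apply: prodr_ge0 => i _; case: ifP => _; lra.
apply: (@le_trans _ _
  (\sum_(S : {set 'I_n}) expR (lambda * (#|S|%:R - n%:R * p) - t) * q S)).
  rewrite [leLHS]big_mkcond; apply: ler_sum => S _.
  case: ifP => DS; last by rewrite mulr_ge0 ?expR_ge0.
  rewrite (Pr_hits_eq _ mB pE) -/(q S) ler_peMl //.
  by apply: le_trans (expR_ge1Dx _); rewrite lerDl subr_ge0.
(* The binomial moment generating function: expanding the n-fold product yields one term per subset
   [S]. It is bounded below by [1 + z <= expR z] with [z = p * (expR lambda - 1)]. *)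
have -> : \sum_(S : {set 'I_n}) expR (lambda * (#|S|%:R - n%:R * p) - t) * q S
    = expR (- (lambda * (n%:R * p)) - t) * (p * expR lambda + (1 - p)) ^+ n.
  rewrite -[in _ ^+ n](card_ord n) -prodr_const bigA_distr mulr_sumr.
  apply: eq_bigr => S _.
  have -> : expR (lambda * (#|S|%:R - n%:R * p) - t)
      = expR (- (lambda * (n%:R * p)) - t)
        * \prod_(i : 'I_n) (if i \in S then expR lambda else 1).
    rewrite -big_mkcond /= prodr_const -expRM_natl -expRD; congr expR; ring.
  rewrite -mulrA -big_split; congr (_ * _); apply: eq_bigr => i _ /=.
  by case: ifP => _; rewrite ?mul1r // mulrC.
have -> : n%:R * p * (expR lambda - 1 - lambda) - t
    = (- (lambda * (n%:R * p)) - t) + n%:R * (p * (expR lambda - 1)) by ring.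
rewrite [leRHS]expRD ler_pM2l ?expR_gt0 // expRM_natl.
have := expR_ge0 lambda => e0.
apply: lerXn2r; rewrite ?nnegrE ?expR_ge0 //.
  by rewrite addr_ge0 ?mulr_ge0 // subr_ge0.
by apply: le_trans (expR_ge1Dx _); lra.
Qed.

(* Chernoff's bound with lambda = +/- sqrt (x / k). *)
Lemma Pr_hits_deviation B (k x : R) : measurable B -> 0 < k ->
  n%:R * Pr P (X @^-1` B) <= k -> 0 <= x -> 16 * x <= k ->
  Pr P [set w | 2 * Num.sqrt (k * x)
                < `|#|hits B w|%:R - n%:R * Pr P (X @^-1` B)|]
  <= 2 * expR (- x).
Proof.
move=> mB k0 npk x0 xk; set p := Pr P _ in npk *.
have p0 : 0 <= p by exact: Pr_ge0.
pose lambda (b : bool) : R := (-1) ^+ b * Num.sqrt (x / k).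
pose E b := [set w | 2 * x <= lambda b * (#|hits B w|%:R - n%:R * p)].
have mhits (Q : {set 'I_n} -> Prop) : measurable [set w | Q (hits B w)].
  exact/fin_measurable_prop/fin_measurable_hits.
have mE b : measurable (E b).
  exact: (mhits (fun S => 2 * x <= lambda b * (#|S|%:R - n%:R * p))).
have sqrt_lambda : Num.sqrt (x / k) * (2 * Num.sqrt (k * x)) = 2 * x.
  rewrite mulrCA -sqrtrM ?divr_ge0 // ?(ltW k0) //.
  have -> : x / k * (k * x) = x ^+ 2 by field; rewrite gt_eqF.
  by rewrite sqrtr_sqr ger0_norm.
apply: (@le_trans _ _ (Pr P [set w | exists2 b, xpredT b & E b w])).
  apply: le_Pr.
  - exact: (mhits (fun S => 2 * Num.sqrt (k * x) < `|#|S|%:R - n%:R * p|)).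
  - exact: (mhits (fun S => exists2 b, xpredT b
      & 2 * x <= lambda b * (#|S|%:R - n%:R * p))).
  - move=> w /= hw.
    (* The Boolean is the sign of the deviation, so [lambda b] times the deviation is [sqrt (x / k)]
       times its absolute value. *)
    exists (#|hits B w|%:R - n%:R * p < 0) => //; rewrite /E /= /lambda.
    rewrite mulrAC -normrEsign [leRHS]mulrC -sqrt_lambda.
    by apply: ler_wpM2l; rewrite ?sqrtr_ge0 // ltW.
apply: le_trans (Pr_exists_le P xpredT mE) _.
have lambda2 b : lambda b ^+ 2 = x / k.
  by rewrite exprMn sqrr_sign mul1r sqr_sqrtr // divr_ge0 // ltW.
have bnd b : Pr P (E b) <= expR (- x).
  (* The exponent is at most [k * (x / k) - 2 * x = - x]. The quadratic bound applies because
     [16 * x <= k] means [|lambda b| <= 1/4]. *)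
  apply: le_trans (Pr_hits_mgf _ _ mB erefl) _; rewrite ler_expR -/p.
  have := @expR_le_quadratic R (lambda b).
  rewrite lambda2 => quad.
  have {}quad : expR (lambda b) - 1 - lambda b <= x / k.
    rewrite -addrA -opprD lerBlDl; apply: quad.
    rewrite -sqrtr_sqr lambda2 -[leRHS]ger0_norm // -sqrtr_sqr ler_wsqrtr //.
    by rewrite ler_pdivrMr //; lra.
  have : n%:R * p * (expR (lambda b) - 1 - lambda b) <= k * (x / k).
    apply: le_trans (_ : n%:R * p * (x / k) <= _).
      by apply: ler_wpM2l; rewrite ?mulr_ge0.
    by apply: ler_wpM2r; rewrite ?divr_ge0 // ltW.
  have -> : k * (x / k) = x by field; rewrite gt_eqF.
  lra.
by rewrite big_bool mulrDl !mul1r; apply: lerD; exact: bnd.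
Qed.

End Concentration.

(** * Empirical tail correlations *)

Section EmpiricalTailCorrelations.
Context (R : realType) (disp : measure_display) (T : measurableType disp)
        (P : probability T R) (d n k : nat) (X : {RV P >-> d.-tuple R})
        (Xs : 'I_n -> {RV P >-> d.-tuple R}) (tie : 'I_d -> T -> 'S_n).
Local Open Scope classical_set_scope.

(** The estimator sees the sample only through this value in a finite type. *)
Definition top_sets (w : T) : {ffun 'I_d -> {set 'I_n}} :=
  [ffun j => top_set k (fun i => tnth (Xs i w) j) (tie j w)].

Definition chi_of_top_sets (S : {ffun 'I_d -> {set 'I_n}}) (j l : 'I_d) : R :=
  k%:R^-1 * #|S j :&: S l|%:R.

Lemma chi_hatE w :
  chi_hat k (fun i => Xs i w) (fun j => tie j w) = chi_of_top_sets (top_sets w).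
Proof.
apply/funext => j; apply/funext => l; congr (_ * _%:R).
by apply: eq_card => i; rewrite !ffunE !inE.
Qed.

(** Top sets are a function of finitely many pairwise comparisons and of the tie-breaking
    permutations; [g] below is that function. *)
Lemma fin_measurable_top_sets :
  (forall j s, measurable [set w | tie j w = s]) -> fin_measurable top_sets.
Proof.
move=> mtie; apply: fin_measurable_ffun => j.
pose x w i := tnth (Xs i w) j.
have mx i : measurable_fun [set: T] (fun w => x w i) by exact: measurable_coord.
pose lts w := [set p : 'I_n * 'I_n | x w p.1 < x w p.2]%SET.
pose eqs w := [set p : 'I_n * 'I_n | x w p.1 == x w p.2]%SET.
have mbool (b : T -> bool) :
    measurable_fun [set: T] b -> measurable [set w | b w].
  move=> mb; have := mb measurableT [set true] I; rewrite setTI.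
  by congr measurable; apply/seteqP; split => w.
have mlts : fin_measurable lts.
  by apply: fin_measurable_set => p; apply: mbool; exact: measurable_fun_ltr.
have meqs : fin_measurable eqs.
  by apply: fin_measurable_set => p; apply: mbool; exact: measurable_fun_eqr.
pose g (q : {set 'I_n * 'I_n} * {set 'I_n * 'I_n} * 'S_n) : {set 'I_n} :=
  [set i | (n - k < #|[set i' | ((i', i) \in q.1.1)
                 || (((i', i) \in q.1.2) && (q.2 i' <= q.2 i)%N)]%SET|)%N]%SET.
have := fin_measurable_comp g
  (fin_measurable_pair (fin_measurable_pair mlts meqs) (mtie j)).
congr fin_measurable; apply/funext => w /=; apply/setP => i.
rewrite !inE /rank_of; congr (_ < _)%N.
by apply: eq_card => i'; rewrite !inE.
Qed.

Context (hcont : forall j, continuous (margin_cdf X j)).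
Context (iidXs : iid_sample X Xs) (hk : (0 < k <= n)%N).

Let u : R := k%:R / n%:R.
Let k_gt0 : 0 < k%:R :> R. Proof. by rewrite ltr0n; case/andP: hk. Qed.
Let n_gt0 : 0 < n%:R :> R.
Proof. by rewrite ltr0n; case/andP: hk => /leq_trans; apply. Qed.
Let nu : n%:R * u = k%:R. Proof. by rewrite /u mulrC divfK // gt_eqF. Qed.

Let N j := hits Xs (tail_region X j u).

Lemma n_Pr_tail_event j : n%:R * Pr P (X @^-1` tail_region X j u) = k%:R.
Proof.
rewrite -tail_event_preimage Pr_tail_event // divr_gt0 //=.
by rewrite ler_pdivrMr // mul1r ler_nat; case/andP: hk.
Qed.

(** Triangle inequality through the joint count with known margins. Top sets have exactly [k]
    elements, so the marginal deviation from [k] bounds each nested difference. *)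
Lemma chi_hat_error (s1 s2 : R) w j l :
  (forall j, `|#|N j w|%:R - k%:R| <= s1) ->
  `|#|N j w :&: N l w|%:R
    - n%:R * Pr P (tail_event X j u `&` tail_event X l u)| <= s2 ->
  `|chi_hat k (fun i => Xs i w) (fun j => tie j w) j l - chi_nk X n k j l|
    <= (s2 + 2 * s1) / k%:R.
Proof.
move=> e1 e2.
have kn : (k <= n)%N by case/andP: hk.
pose S j := top_set k (fun i => tnth (Xs i w) j) (tie j w).
have nested j' : (S j' \subset N j' w) || (N j' w \subset S j').
  apply: top_set_nested => i i'; rewrite /N !inE /tail_region /= => iN ii'.
  by apply: lt_le_trans iN _; exact: cdf_nondecreasing.
have e1' j' : `|#|N j' w|%:R - #|S j'|%:R| <= s1 by rewrite card_top_set.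
have := nested_cap_dist (nested j) (nested l) (e1' j) (e1' l).
rewrite chi_hatE /chi_of_top_sets /chi_nk -/u !ffunE -/(S j) -/(S l).
set p := Pr P _ in e2 *; move=> e3.
have -> : k%:R^-1 * #|S j :&: S l|%:R - n%:R / k%:R * p
    = (#|S j :&: S l|%:R - n%:R * p) / k%:R.
  by rewrite mulrBl mulrC [n%:R / _]mulrC -mulrA [X in _ - X]mulrC.
rewrite normrM [`|k%:R^-1|]ger0_norm ?invr_ge0 ?(ltW k_gt0) //.
apply: ler_wpM2r; first by rewrite invr_ge0 ltW.
apply: le_trans (ler_distD #|N j w :&: N l w|%:R _ _) _.
by rewrite addrC lerD.
Qed.

(** Union bound with exponent [x] for the marginal counts and [y] for the joint ones. Only the
    larger event [E] has to be measurable. *)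
Lemma Pr_chi_hat_close (x y : R) (E : set T) :
  0 <= x -> 0 <= y -> 16 * x <= k%:R -> 16 * y <= k%:R -> measurable E ->
  (forall w, (forall j l, j != l ->
     `|chi_hat k (fun i => Xs i w) (fun j => tie j w) j l - chi_nk X n k j l|
     <= (2 * Num.sqrt (k%:R * y) + 2 * (2 * Num.sqrt (k%:R * x))) / k%:R) ->
     E w) ->
  1 - (\sum_(j < d) 2 * expR (- x)
       + \sum_(p : 'I_d * 'I_d | p.1 != p.2) 2 * expR (- y)) <= Pr P E.
Proof.
move=> x0 y0 xk yk mE closeE.
pose dev B s w := s < `|#|hits Xs B w|%:R - n%:R * Pr P (X @^-1` B)|.
have mdev B s : measurable B -> measurable [set w | dev B s w].
  move=> mB; exact: (fin_measurable_prop
    (fun S : {set 'I_n} => s < `|#|S|%:R - n%:R * Pr P (X @^-1` B)|)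
    (fin_measurable_hits Xs mB)).
pose B1 j := tail_region X j u.
pose B2 (p : 'I_d * 'I_d) := B1 p.1 `&` B1 p.2.
have mB1 j : measurable (B1 j) by exact: measurable_tail_region.
have mB2 p : measurable (B2 p) by exact: measurableI.
pose U := [set w | exists2 j, xpredT j &
  [set w | dev (B1 j) (2 * Num.sqrt (k%:R * x)) w] w].
pose V := [set w | exists2 p, p.1 != p.2 &
  [set w | dev (B2 p) (2 * Num.sqrt (k%:R * y)) w] w].
have mexists (I : finType) (D : pred I) (F : I -> set T) :
    (forall i, measurable (F i)) -> measurable [set w | exists2 i, D i & F i w].
  move=> mF; have -> : [set w | exists2 i, D i & F i w] = \bigcup_(i in D) F i.
    by [].
  by apply: fin_bigcup_measurable => [|i _]; [exact: finite_finset | exact: mF].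
have mU : measurable U by apply: mexists => j; exact: mdev.
have mV : measurable V by apply: mexists => p; exact: mdev.
have PU : Pr P U <= \sum_(j < d) 2 * expR (- x).
  apply: le_trans (Pr_exists_le _ _ _) _ => [j|]; first exact: mdev.
  apply: ler_sum => j _; apply: Pr_hits_deviation => //.
  by rewrite n_Pr_tail_event.
have PV : Pr P V <= \sum_(p : 'I_d * 'I_d | p.1 != p.2) 2 * expR (- y).
  apply: le_trans (Pr_exists_le _ _ _) _ => [p|]; first exact: mdev.
  apply: ler_sum => p _; apply: Pr_hits_deviation => //.
  (* A joint exceedance is a marginal one, so the joint count also has mean at most [k]. *)
  rewrite -[leRHS](n_Pr_tail_event p.1) ler_pM2l //.
  apply: le_Pr; last by move=> w [].
    exact: measurable_RV_preimage (mB2 p).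
  exact: measurable_RV_preimage (mB1 p.1).
have PUV : Pr P (U `|` V) <= Pr P U + Pr P V.
  by have := Pr_ge0 P (U `&` V); rewrite Pr_setI //; lra.
have mUV : measurable (U `|` V) by exact: measurableU.
apply: (@le_trans _ _ (Pr P (~` (U `|` V)))); first by rewrite Pr_setC //; lra.
apply: le_Pr => //; first exact: measurableC.
move=> w /not_orP[nU nV]; apply: closeE => j l jl.
apply: chi_hat_error.
  move=> j'; rewrite leNgt; apply/negP => bad; apply: nU; exists j' => //=.
  by rewrite /dev n_Pr_tail_event.
rewrite leNgt; apply/negP => bad; apply: nV; exists (j, l) => //=.
rewrite /dev; move: bad; congr (_ < `|_%:R - _|).
by apply: eq_card => i; rewrite !inE -asbool_and.
Qed.

End EmpiricalTailCorrelations.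

(** * The constants of kappa0 and the theorem *)

Section Constants.
Context (R : realType) (k x y : R).
Context (k0 : 0 < k) (x0 : 0 <= x) (y0 : 0 <= y).

Let c : R := (Num.sqrt 2 + Num.sqrt (16 * y) + Num.sqrt (16 * x)) / Num.sqrt k
  + (6 + 4 * y + 8 * x) / (3 * k).

Let sqrt16 (z : R) : Num.sqrt (16 * z) = 4 * Num.sqrt z.
Proof.
rewrite sqrtrM //; congr (_ * _).
by rewrite (_ : 16 = 4 ^+ 2 :> R) ?sqrtr_sqr ?ger0_norm // -natrX.
Qed.

(** The left side is [(sqrt (16 y) + sqrt (16 x)) / sqrt k]; the remaining terms of [c] are
    nonnegative. *)
Lemma deviation_le_kappa0 :
  (2 * Num.sqrt (k * (4 * y)) + 2 * (2 * Num.sqrt (k * x))) / k <= c.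
Proof.
have sk : 0 < Num.sqrt k by rewrite sqrtr_gt0.
have s4 : Num.sqrt (k * (4 * y)) = 2 * (Num.sqrt k * Num.sqrt y).
  rewrite mulrCA sqrtrM // (_ : 4 = 2 ^+ 2 :> R) -?natrX //.
  by rewrite natrX sqrtr_sqr ger0_norm // sqrtrM // ltW.
have -> : (2 * Num.sqrt (k * (4 * y)) + 2 * (2 * Num.sqrt (k * x))) / k
    = (4 * Num.sqrt y + 4 * Num.sqrt x) / Num.sqrt k.
  rewrite s4 (sqrtrM _ (ltW k0)) -[X in _ / X](sqr_sqrtr (ltW k0)).
  by field; rewrite gt_eqF.
rewrite /c !sqrt16 -[leLHS]addr0 lerD //.
  by rewrite ler_pM2r ?invr_gt0 // -addrA lerDr sqrtr_ge0.
by rewrite divr_ge0 ?addr_ge0 ?mulr_ge0 ?(ltW k0).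
Qed.

(** The hypotheses give [4 * sqrt z / sqrt k <= 1/4]; squaring [16 * sqrt z <= sqrt k] concludes. It
    is used for [z] equal to [x] and to [y]. *)
Lemma le_of_kappa0_small (z : R) : 0 <= z ->
  Num.sqrt (16 * z) <= Num.sqrt (16 * y) + Num.sqrt (16 * x) ->
  c <= 4^-1 -> 256 * z <= k.
Proof.
move=> z0 zxy c4.
have sk : 0 < Num.sqrt k by rewrite sqrtr_gt0.
have tail0 : 0 <= (6 + 4 * y + 8 * x) / (3 * k).
  by rewrite divr_ge0 ?addr_ge0 ?mulr_ge0 ?(ltW k0).
have : (4 * Num.sqrt z) / Num.sqrt k <= 4^-1.
  apply: le_trans c4; rewrite /c -[leLHS]addr0 lerD //.
  rewrite ler_pM2r ?invr_gt0 // -sqrt16 -addrA.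
  by apply: le_trans zxy _; rewrite lerDr sqrtr_ge0.
rewrite ler_pdivrMr // => le4.
rewrite -(sqr_sqrtr (ltW k0)) -{1}(sqr_sqrtr z0).
rewrite (_ : 256 * _ = (16 * Num.sqrt z) ^+ 2); last by ring.
by rewrite ler_pXn2r ?nnegrE ?mulr_ge0 ?sqrtr_ge0 //; lra.
Qed.

End Constants.

Lemma expRN_ln (R : realType) (z : R) : 0 < z -> expR (- ln z) = z^-1.
Proof. by move=> z0; rewrite expRN lnK. Qed.

Lemma union_bound_delta (R : realType) (d : nat) (delta : R) :
  (0 < d)%N -> 0 < delta < 1 ->
  \sum_(j < d) 2 * expR (- ln (4 * d%:R / delta))
  + \sum_(p : 'I_d * 'I_d | p.1 != p.2) 2 * expR (- (4 * ln (d%:R / delta)))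
  <= delta.
Proof.
move=> d0 /andP[delta0 delta1].
have dR : 0 < d%:R :> R by rewrite ltr0n.
have -> : \sum_(j < d) 2 * expR (- ln (4 * d%:R / delta)) = delta / 2.
  rewrite sumr_const card_ord expRN_ln ?divr_gt0 ?mulr_gt0 // -mulr_natl.
  by field; rewrite !gt_eqF.
suff : \sum_(p : 'I_d * 'I_d | p.1 != p.2) 2 * expR (- (4 * ln (d%:R / delta)))
    <= delta / 2 by lra.
(* For [d = 1] there are no pairs. Otherwise at most d^2 pairs contribute [2 * (delta / d)^4] each,
   and [2 / d <= 1] brings the total below [delta / 2]. *)
have [d1|d2] := leqP d 1.
  rewrite big_pred0 ?divr_ge0 ?(ltW delta0) // => -[i j] /=.
  apply/negbTE; rewrite negbK; apply/eqP/val_inj => /=.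
  by case: i j => [i id] [j jd] /=; move: id jd d1; lia.
apply: (@le_trans _ _
  (\sum_(p : 'I_d * 'I_d) 2 * expR (- (4 * ln (d%:R / delta))))).
  rewrite [leLHS]big_mkcond; apply: ler_sum => p _.
  by case: ifP => // _; rewrite mulr_ge0 ?expR_ge0.
rewrite sumr_const card_prod card_ord -[leLHS]mulr_natl natrM.
have -> : expR (- (4 * ln (d%:R / delta))) = (delta / d%:R) ^+ 4.
  by rewrite -mulrN expRM_natl expRN_ln ?divr_gt0 // invf_div.
have -> : d%:R * d%:R * (2 * (delta / d%:R) ^+ 4)
    = delta / 2 * (delta ^+ 3 * (2 / d%:R) ^+ 2) by field; rewrite gt_eqF.
rewrite ler_piMr ?divr_ge0 ?(ltW delta0) //.
apply: mulr_ile1; rewrite ?exprn_ge0 ?exprn_ile1 ?divr_ge0 //;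
  rewrite ?(ltW delta0) ?(ltW delta1) //.
by rewrite ler_pdivrMr // mul1r ler_nat.
Qed.

Theorem theorem3p2 (R : realType) (disp : measure_display)
  (T : measurableType disp) (P : probability T R)
  (d n : nat)
  (X : {RV P >-> d.-tuple R})
  (hcont : forall j : 'I_d, continuous (margin_cdf X j))
  (L : ('I_d -> R) -> R) (hL : is_stdf X L)
  (K : nat) (A : 'M[R]_(d, K)) (hA : in_ThetaL A)
  (hLA : forall x : 'I_d -> R, (forall j, 0 <= x j) ->
     L x = linear_factor_stdf A x)
  (Xs : 'I_n -> {RV P >-> d.-tuple R}) (hiid : iid_sample X Xs)
  (tie : 'I_d -> T -> {perm 'I_n})
  (htie : forall j s, measurable [set w | tie j w = s]%classic)
  (k : nat) (hk : (0 < k <= n)%N)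
  (delta : R) (hdelta : 0 < delta < 1) :
  ((1 - delta)%:E <=
    P [set w | forall kappa : R,
         (kappa0 X delta n k <= kappa < eta A / 2)%R ->
         forall (Khat : nat) (Ihat : {set 'I_d})
                (Ihats : 'I_Khat -> {set 'I_d}),
         purevar_output
           (chi_hat k (fun i => Xs i w) (fun j => tie j w))
           kappa Ihat Ihats ->
         exists eK : Khat = K,
           Ihat = pure_union A /\
           exists pi : {perm 'I_K}, forall a : 'I_Khat,
             Ihats a = pure_set A (pi (cast_ord eK a))]%classic)%E.
Proof.
set E := [set w | _]%classic.
have mE : measurable E.
  pose Q (c : 'I_d -> 'I_d -> R) := forall kappa : R,
    (kappa0 X delta n k <= kappa < eta A / 2)%R ->
    forall (Khat : nat) (Ihat : {set 'I_d}) (Ihats : 'I_Khat -> {set 'I_d}),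
    purevar_output c kappa Ihat Ihats ->
    exists eK : Khat = K,
      Ihat = pure_union A /\
      exists pi : {perm 'I_K}, forall a : 'I_Khat,
        Ihats a = pure_set A (pi (cast_ord eK a)).
  have -> : E = [set w | Q (chi_of_top_sets R k (top_sets k Xs tie w))]%classic.
    by apply/funext => w; rewrite /E /mkset /Q chi_hatE.
  apply: (fin_measurable_prop (fun S => Q (chi_of_top_sets R k S))).
  exact: fin_measurable_top_sets.
rewrite -PrE // lee_fin.
have /andP[delta0 delta1] := hdelta.
have d0 : (0 < d)%N by case: hA => /andP[K0 Kd] _ _ _; exact: leq_trans K0 Kd.
have dR : 1 <= d%:R :> R by rewrite ler1n.
have k0 : 0 < k%:R :> R by rewrite ltr0n; case/andP: hk.
(* If [kappa0 >= eta A / 2], no [kappa] is admissible and the event is the whole space. *)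
have [small|large] := ltP (kappa0 X delta n k) (eta A / 2); last first.
  have -> : E = setT.
    apply/seteqP; split => // w _ kappa /andP[lo hi].
    by have := le_lt_trans (le_trans large lo) hi; rewrite ltxx.
  by rewrite /Pr probability_setT /=; lra.
pose y := ln (d%:R / delta); pose x := ln (4 * d%:R / delta).
have y0 : 0 <= y.
  by apply: ln_ge0; rewrite ler_pdivlMr // mul1r; lra.
have x0 : 0 <= x.
  by apply: ln_ge0; rewrite ler_pdivlMr // mul1r; lra.
have bias0 : 0 <= bias X n k by exact: bigmax_ge_id.
have kappa0_ge := deviation_le_kappa0 k0 x0 y0.
have kappa0E : kappa0 X delta n k = bias X n k +
   ((Num.sqrt 2 + Num.sqrt (16 * y) + Num.sqrt (16 * x)) / Num.sqrt k%:R
  + (6 + 4 * y + 8 * x) / (3 * k%:R)) by rewrite /kappa0 -addrA.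
have c4 : (Num.sqrt 2 + Num.sqrt (16 * y) + Num.sqrt (16 * x)) / Num.sqrt k%:R
  + (6 + 4 * y + 8 * x) / (3 * k%:R) <= 4^-1.
  by move: small; rewrite kappa0E; have := eta_le_half A; lra.
have xk : 256 * x <= k%:R.
  by apply: le_of_kappa0_small c4; rewrite // lerDr sqrtr_ge0.
have yk : 256 * y <= k%:R.
  by apply: le_of_kappa0_small c4; rewrite // lerDl sqrtr_ge0.
(* Exponent [4 * y] for the joint counts yields the fourth power of [delta / d] that pays for all
   pairs, and [16 * (4 * y) <= k] follows from [yk]. *)
apply: le_trans (Pr_chi_hat_close hcont hiid hk (x := x) (y := 4 * y)
  (tie := tie) _ _ _ _ mE _).
- by have := union_bound_delta d0 hdelta; rewrite -/x -/y; lra.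
- by [].
- by lra.
- by lra.
- by lra.
move=> w close kappa /andP[lo hi] Khat Ihat Ihats.
apply: purevar_recovery => //.
  apply: le_trans lo; rewrite kappa0E addr_ge0 //.
  by apply: le_trans kappa0_ge; rewrite divr_ge0 ?(ltW k0).
move=> j l jl; apply: le_trans lo; rewrite kappa0E.
(* Through [chi_nk], the error splits into the bias and the stochastic deviation, the two parts of
   [kappa0]. *)
apply: le_trans (ler_distD (chi_nk X n k j l) _ _) _.
rewrite addrC lerD //.
  rewrite -(chi_tail_corr hL hA hLA jl).
  exact: (le_bigmax_cond _ (j := (j, l))).
exact: le_trans (close _ _ jl) kappa0_ge.
Qed.
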